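(* Let $b\ge 2$ be an integer such that both $b$ and $b-4$ are squarefree, and let $n\ge 3$ be an integer. For every integer $m\ge 2$ write $\mathcal{G}_{m,b}(x):=x^{2m}+bx^m+b$. Then $\mathcal{G}_{n,b}(x)$ is monogenic if and only if $\mathcal{G}_{p,b}(x)$ is monogenic for every prime divisor $p$ of $n$.
   Context: A monic polynomial $f(x)\in\mathbb{Z}[x]$ of degree $N\ge 2$ is called monogenic if $f(x)$ is irreducible over $\mathbb{Q}$ and $\{1,\theta,\theta^2,\ldots,\theta^{N-1}\}$ is a basis (over $\mathbb{Z}$) for the ring of integers of $\mathbb{Q}(\theta)$, where $f(\theta)=0$. An integer (possibly negative) is squarefree if it is not divisible by $m^2$ for any integer $m>1$; in particular $0$ is not squarefree. *)

(* Defs.v *)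
From HB Require Import structures.
From mathcomp Require Import all_boot all_order all_algebra all_field.

Set Implicit Arguments.
Unset Strict Implicit.
Unset Printing Implicit Defensive.

Import Order.TTheory GRing.Theory Num.Theory.

Local Open Scope ring_scope.

(* Since m ^+ 2 divides 0 for every m, 0 is not squarefree; signs are irrelevant. *)
Definition squarefreez (a : int) : Prop :=
  forall m : int, 1 < m -> ~ (m ^+ 2 %| a)%Z.

Definition ring_of_integers (L : fieldExtType rat) (K : {subfield L}) (z : L)
    : Prop :=
  z \in K /\ integralOver (intr : int -> L) z.

Definition Zbasis (V : zmodType) (M : V -> Prop) (N : nat) (e : 'I_N -> V)
    : Prop :=
  [/\ forall i, M (e i),
      forall c : 'I_N -> int, \sum_(i < N) e i *~ c i = 0 -> forall i, c i = 0
    & forall z, M z -> exists c : 'I_N -> int, z = \sum_(i < N) e i *~ c i].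

(* The degree of f is (size f).-1, so 2 < size f says that it is at least 2.
   theta ranges over the roots of f in finite extensions L of the rationals, and
   <<1; theta>> is the subfield Q(theta) of L; such L and theta exist by
   irredp_FAdjoin, so the last clause is never vacuous. *)
Definition monogenic (f : {poly int}) : Prop :=
  [/\ f \is monic,
      (2 < size f)%N,
      irreducible_poly (map_poly intr f : {poly rat})
    & forall (L : fieldExtType rat) (theta : L),
        root (map_poly intr f) theta ->
        Zbasis (ring_of_integers <<1; theta>>%AS)
               (fun i : 'I_(size f).-1 => theta ^+ i)].

Definition Gpoly (m : nat) (b : int) : {poly int} :=
  'X^(2 * m) + b *: 'X^m + b%:P.

(* Main.v *)
(* Dedekind's criterion in Uchida's form: a monic irreducible f is monogenic iff
   f lies in no (q, P)^2 with q prime and P nonconstant modulo q.  If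
   f = P^2 A + q P B + q^2 C, then ((P A + q B) / q)(theta) is integral, being a
   root of X^2 - B(theta) X + (A C)(theta), but lies outside Z[theta].
   Conversely, if Z[theta] is not q-maximal, then some U(theta) / q is integral,
   where U P = f modulo q and P is irreducible modulo q, and integrality forces
   f into (q, P)^2.
   Substituting X^m for X turns a decomposition of G_k into one of G_{mk}.  In
   the other direction, let G_n be in (q, P)^2.  If q does not divide n, then
   either X is in (q, P), so that q^2 | b, or the derivative shows that 2 X^n + b
   is in (q, P), and 4 G_n = (2 X^n + b)^2 - b (b - 4) gives q^2 | b - 4.  If
   n = m q, then G_q = g^q + q D with g = X^2 + b X + b, so that g(X^m) and
   D(X^m) are both in (q, P); hence g and D have a common factor modulo q, and
   G_q is in the square of the corresponding ideal. *)
Require Import Defs.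
From mathcomp Require Import all_boot all_order all_algebra all_field.
From mathcomp Require Import ring zify.

Set Implicit Arguments.
Unset Strict Implicit.
Unset Printing Implicit Defensive.

Import Order.TTheory GRing.Theory Num.Theory.

Local Open Scope ring_scope.

(** * Reduction of integer polynomials modulo a prime *)

Local Notation redp q h := (map_poly (intr : int -> 'F_q) h).

Lemma redp_nat q : prime q -> redp q q%:R = 0.
Proof.
by move=> q_pr; rewrite rmorph_nat -polyC_natr (pcharf0 (pchar_Fp q_pr)).
Qed.

Lemma redp_surj q (u : {poly 'F_q}) : exists h, redp q h = u.
Proof.
exists (map_poly (fun x : 'F_q => (x : nat)%:Z) u).
apply/polyP=> i; rewrite !coef_map_id0 //=.
exact: natr_Zp.
Qed.

Lemma redp_eq0 q h : prime q -> redp q h = 0 -> exists k, h = q%:R * k.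
Proof.
move=> q_pr h0; exists (map_poly (fun c => (c %/ q)%Z) h).
apply/polyP=> i; rewrite mulr_natl coefMn coef_map_id0 ?div0z //.
have : (redp q h)`_i == 0 by rewrite h0 coef0.
rewrite coef_map /= -(dvdz_pcharf (pchar_Fp q_pr)) => /divzK {1}<-.
by rewrite -mulr_natr natz.
Qed.

(** Links two views of the ideal [(q, P)]: explicit combinations over Z, suited to [ring], and
    divisibility over the field ['F_q]. *)
Lemma redp_dvdP q (P h : {poly int}) : prime q ->
  reflect (exists E F, h = P * E + q%:R * F) (redp q P %| redp q h).
Proof.
move=> q_pr; apply: (iffP idP) => [/dvdpP[e] | [E [F ->]]].
  have [E <-] := redp_surj e => hE.
  have /(redp_eq0 q_pr)[F hF] : redp q (h - E * P) = 0.
    by rewrite rmorphB rmorphM /= hE subrr.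
  by exists E, F; rewrite -hF; ring.
by rewrite rmorphD !rmorphM /= redp_nat // mul0r addr0 dvdp_mulIl.
Qed.

(** * Squares of the ideals [(q, P)] of Z[X] *)

(* Membership in the ideal (q, P)^2 of Z[X]. *)
Definition sq_ideal (q : nat) (P h : {poly int}) : Prop :=
  exists A B C, h = P ^+ 2 * A + q%:R * P * B + q%:R ^+ 2 * C.

Lemma sq_idealD q P g h :
  sq_ideal q P g -> sq_ideal q P h -> sq_ideal q P (g + h).
Proof.
move=> [A [B [C ->]]] [A' [B' [C' ->]]].
by exists (A + A'), (B + B'), (C + C'); ring.
Qed.

Lemma sq_idealMr q P g h : sq_ideal q P g -> sq_ideal q P (g * h).
Proof.
move=> [A [B [C ->]]].
by exists (A * h), (B * h), (C * h); ring.
Qed.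

Lemma sq_idealN q P g : sq_ideal q P g -> sq_ideal q P (- g).
Proof. by move=> /(sq_idealMr (-1)); rewrite mulrN1. Qed.

Lemma sq_ideal_mul q P g h : prime q ->
  redp q P %| redp q g -> redp q P %| redp q h -> sq_ideal q P (g * h).
Proof.
move=> q_pr /(redp_dvdP _ _ q_pr)[E [F ->]] /(redp_dvdP _ _ q_pr)[E' [F' ->]].
by exists (E * E'), (E * F' + E' * F), (F * F'); ring.
Qed.

Lemma sq_idealX q P h k : prime q -> (1 < k)%N ->
  redp q P %| redp q h -> sq_ideal q P (h ^+ k).
Proof.
case: k => [|[|k]] // q_pr _ Ph.
by rewrite !exprS mulrA; apply/sq_idealMr/sq_ideal_mul.
Qed.

Lemma sq_ideal_dvd q P h : prime q ->
  sq_ideal q P h -> redp q P %| redp q h.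
Proof.
move=> q_pr [A [B [C ->]]]; apply/(redp_dvdP _ _ q_pr).
by exists (P * A + q%:R * B), (q%:R * C); ring.
Qed.

(** Modulo [q] the decomposition reads [P ^+ 2 * A = 0], so [A] is a multiple of [q], and one factor
    [q] cancels throughout. *)
Lemma sq_ideal_cancel q P h : prime q -> redp q P != 0 ->
  sq_ideal q P (q%:R * h) -> redp q P %| redp q h.
Proof.
move=> q_pr P0 [A [B [C hE]]].
have /(redp_eq0 q_pr)[A' A'E] : redp q A = 0.
  apply/eqP; have /eqP := congr1 (map_poly (intr : int -> 'F_q)) hE.
  rewrite !(rmorphD, rmorphM) /= redp_nat // !mul0r !addr0 eq_sym.
  by rewrite !mulf_eq0 (negPf P0).
apply/(redp_dvdP _ _ q_pr); exists (P * A' + B), C.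
have q0 : q%:R != 0 :> {poly int}.
  by rewrite -polyC_natr polyC_eq0 pnatr_eq0 -lt0n prime_gt0.
by apply: (mulfI q0); rewrite hE A'E; ring.
Qed.

(** A constant divisible by a nonconstant polynomial over ['F_q] is zero. This is applied to [c],
    then to [c / q] after one [q] is cancelled. *)
Lemma sq_ideal_const q P (c : int) : prime q -> (1 < size (redp q P))%N ->
  sq_ideal q P c%:P -> ((q%:Z) ^+ 2 %| c)%Z.
Proof.
move=> q_pr P1 hc.
have P0 : redp q P != 0 by rewrite -size_poly_gt0 (ltn_trans _ P1).
have dvd_const (d : int) : redp q P %| redp q d%:P -> (q %| d)%Z.
  rewrite map_polyC /= (dvdz_pcharf (pchar_Fp q_pr)); apply: contraTT => d0.
  apply/negP => /dvdp_leq; rewrite polyC_eq0 d0 => /(_ isT).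
  by rewrite size_polyC d0 leqNgt P1.
have /dvdzP[d dE] := dvd_const c (sq_ideal_dvd q_pr hc).
rewrite dE expr2 dvdz_mul2r ?dvd_const //; last first.
  by rewrite -lt0n prime_gt0.
apply: sq_ideal_cancel => //; move: hc; rewrite dE polyCM mulrC.
by rewrite -[X in X%:P * _]natz polyC_natr.
Qed.

(** * Evaluation at a root of [f], and integral elements *)

(** Division by the monic [f] stays in Z[X]. A nonzero remainder would be coprime to the irreducible
    [f] over the rationals and could not share the root [theta]. *)
Lemma root_dvd (f V : {poly int}) (L : fieldExtType rat) (theta : L) :
    f \is monic -> irreducible_poly (map_poly intr f : {poly rat}) ->
    root (map_poly intr f) theta -> root (map_poly intr V) theta ->
  exists Q, V = Q * f.
Proof.
move=> f_mon f_irr f0 V0.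
have VE := Pdiv.RingMonic.rdivp_eq f_mon V.
set r := Pdiv.Ring.rmodp V f in VE.
have r_size : (size r < size f)%N by rewrite Pdiv.Ring.ltn_rmodp monic_neq0.
have r0 : root (map_poly intr r) theta.
  move: V0; rewrite {1}VE rmorphD rmorphM /= rootE hornerD hornerM.
  by rewrite (rootP f0) mulr0 add0r.
have intrE (h : {poly int}) :
    map_poly intr h = map_poly (in_alg L) (map_poly intr h : {poly rat}).
  rewrite -map_poly_comp; apply: eq_map_poly => c.
  by rewrite [RHS](rmorph_int (in_alg L)).
have [r_eq0|r_neq0] := eqVneq r 0.
  by exists (Pdiv.Ring.rdivp V f); rewrite {1}VE r_eq0 addr0.
have size_rat (h : {poly int}) : size (map_poly intr h : {poly rat}) = size h.
  by rewrite size_map_inj_poly // => x y /intr_inj.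
have : coprimep (map_poly intr f : {poly rat}) (map_poly intr r).
  rewrite irreducible_poly_coprime //; apply/negP => /dvdp_leq.
  rewrite -size_poly_eq0 !size_rat size_poly_eq0 r_neq0 leqNgt r_size.
  by move/(_ isT).
rewrite -(coprimep_map (in_alg L)) -!intrE => /coprimep_root/(_ f0).
by rewrite (rootP r0) eqxx.
Qed.

Local Notation integral := (integralOver (intr : int -> _)).

Lemma integral_hornerZ (L : fieldExtType rat) (theta : L) (V : {poly int}) :
  integral theta -> integral (map_poly intr V).[theta].
Proof.
move=> int_theta.
apply: (@integral_horner int L intr) => // c /(nthP 0)[i _ <-].
by rewrite coef_map; apply: (integral_id (intr : {rmorphism int -> L})).
Qed.

Lemma irreducible_dvd_exp (F : fieldType) (p t : {poly F}) k :
  irreducible_poly p -> p %| t ^+ k -> p %| t.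
Proof.
move=> p_irr; apply: contraLR; rewrite -!irreducible_poly_coprime //.
exact: coprimep_expr.
Qed.

(* Multiplying an integral equation of alpha by S ^+ deg shows that S divides a
   power of T modulo f. *)
Lemma dvd_integral (q : nat) (f P S T : {poly int}) (L : fieldExtType rat)
    (theta alpha : L) :
    f \is monic -> irreducible_poly (map_poly intr f : {poly rat}) ->
    root (map_poly intr f) theta -> irreducible_poly (redp q P) ->
    redp q P %| redp q f -> redp q P %| redp q S -> integral alpha ->
    alpha * (map_poly intr S).[theta] = (map_poly intr T).[theta] ->
  redp q P %| redp q T.
Proof.
move=> f_mon f_irr f0 P_irr Pf PS [h h_mon h0] ST.
have [k hk] : exists k, size h = k.+1.
  by exists (size h).-1; rewrite prednK // size_poly_gt0 monic_neq0.
pose W := \sum_(i < k.+1) (h`_i)%:P * T ^+ i * S ^+ (k - i).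
have W0 : root (map_poly intr W) theta.
  rewrite rootE rmorph_sum /= horner_sum.
  apply/eqP; transitivity
    ((map_poly intr S).[theta] ^+ k * (map_poly intr h).[alpha]); last first.
    by rewrite (rootP h0) mulr0.
  have hk' : (size (map_poly intr h : {poly L}) <= k.+1)%N.
    by rewrite -hk; apply: size_poly.
  rewrite (horner_coef_wide _ hk') mulr_sumr.
  apply: eq_bigr => i _; rewrite !rmorphM !rmorphXn /= map_polyC /= coef_map.
  rewrite !hornerM !horner_exp hornerC -ST exprMn.
  by rewrite -[in X in _ = _ ^+ X * _](subnK (leq_ord i)) exprD /=; ring.
have [Q WE] := root_dvd f_mon f_irr f0 W0.
have : redp q P %| redp q W by rewrite WE rmorphM dvdp_mull.
(* The summands with [i < k] contain a positive power of [S], so modulo [P] only the top one,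
   [T ^+ k], remains. *)
rewrite /W big_ord_recr /= subnn mulr1 rmorphD dvdp_addr; last first.
  rewrite rmorph_sum; apply: (big_ind (dvdp (redp q P))) => [||i _].
  - exact: dvdp0.
  - by move=> u v; apply: dvdp_add.
  rewrite rmorphM dvdp_mull //= rmorphXn /=.
  rewrite -(prednK (_ : 0 < k - i)%N) ?subn_gt0 //.
  by rewrite exprS dvdp_mulr.
have -> : h`_k = 1 by move/monicP: h_mon; rewrite /lead_coef hk.
by rewrite mul1r rmorphXn; apply: irreducible_dvd_exp.
Qed.

Lemma irreducible_factor (F : finFieldType) (u : {poly F}) :
  (1 < size u)%N -> exists2 v, irreducible_poly v & v %| u.
Proof.
elim: {u}(size u) {-2}u (leqnn (size u)) => [|k IHk] u.
  by rewrite leqn0 => /eqP ->.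
move=> uk u1; have [/irreducibleP u_irr|] := boolP (irreducibleb u).
  by exists u.
rewrite /irreducibleb u1 /= negb_forall => /existsP[[v v_size] /=].
rewrite negb_imply -ltnNge => /andP[vu v1].
have [|//|w w_irr wv] := IHk v.
  by rewrite (leq_trans v_size) // -ltnS prednK // ltnW.
by exists w => //; apply: dvdp_trans wv _; rewrite Pdiv.Idomain.dvdpE.
Qed.

Lemma natr_fieldExt_neq0 (L : fieldExtType rat) (n : nat) :
  (0 < n)%N -> n%:R != 0 :> L.
Proof.
by move=> n0; rewrite -(rmorph_nat (in_alg L)) fmorph_eq0 pnatr_eq0 -lt0n.
Qed.

(** * From the ideal condition to monogenicity *)

(** If the remainder of [G] by [f] is nonzero modulo [q], its gcd [d] with [f] modulo [q] is smaller
    than [f], and [f] falls into [(q, P)^2] for any irreducible factor [P] of the cofactor [e]. *)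
Lemma integral_div_prime (q : nat) (f G : {poly int}) (L : fieldExtType rat)
    (theta z : L) : prime q ->
    f \is monic -> irreducible_poly (map_poly intr f : {poly rat}) ->
    root (map_poly intr f) theta ->
    (forall P, irreducible_poly (redp q P) -> ~ sq_ideal q P f) ->
    integral z -> z * q%:R = (map_poly intr G).[theta] ->
  exists V : {poly int}, z = (map_poly intr V).[theta].
Proof.
move=> q_pr f_mon f_irr f0 f_reg int_z zq.
have q0 : q%:R != 0 :> L by rewrite natr_fieldExt_neq0 // prime_gt0.
have GE := Pdiv.RingMonic.rdivp_eq f_mon G.
set r := Pdiv.Ring.rmodp G f in GE.
have r_size : (size r < size f)%N by rewrite Pdiv.Ring.ltn_rmodp monic_neq0.
have {GE zq} zq : z * q%:R = (map_poly intr r).[theta].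
  rewrite zq {1}GE rmorphD rmorphM /= hornerD hornerM.
  by rewrite (rootP f0) mulr0 add0r.
have [r0|r_neq0] := eqVneq (redp q r) 0.
  have [V VE] := redp_eq0 q_pr r0; exists V; apply: (mulIf q0).
  by rewrite zq VE rmorphM rmorph_nat hornerM -polyC_natr hornerC mulrC.
have fq_mon : redp q f \is monic by rewrite monic_map.
(* The gcd is taken in Bezout form because the lift [S * r + T * f] then takes at [theta] the value
   [q] times an integral element. *)
have [[u1 u2] /= d_gcd] := Bezoutp (redp q r) (redp q f).
set d := (_ + _) in d_gcd.
have d_r : d %| redp q r by rewrite (eqp_dvdl _ d_gcd) dvdp_gcdl.
have /dvdpP[e fE] : d %| redp q f by rewrite (eqp_dvdl _ d_gcd) dvdp_gcdr.
have d_size : (size d < size (redp q f))%N.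
  rewrite (leq_ltn_trans (dvdp_leq r_neq0 d_r)) //.
  rewrite (leq_ltn_trans (size_poly _ _)) // size_map_poly_id0 //.
  by rewrite (monicP f_mon) oner_neq0.
have e0 : e != 0.
  apply: contraTneq fq_mon => e0.
  by rewrite fE e0 mul0r monicE lead_coef0 eq_sym oner_neq0.
have e_size : (1 < size e)%N.
  rewrite ltnNge; apply: contraL d_size => e1.
  rewrite -leqNgt fE (leq_trans (size_polyMleq _ _)) //.
  by rewrite -subn1 leq_subLR leq_add2r.
have [p p_irr /dvdpP[w wE]] := irreducible_factor e_size.
have [P PE] := redp_surj p; have [W WE] := redp_surj w.
have [S SE] := redp_surj u1; have [T TE] := redp_surj u2.
pose U := W * (S * r + T * f).
have UE : redp q U = w * d.
  by rewrite !(rmorphM, rmorphD) /= WE SE TE.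
have /(redp_eq0 q_pr)[H HE] : redp q (f - U * P) = 0.
  by rewrite rmorphB rmorphM /= UE PE fE wE; ring.
have {HE} fH : f = U * P + q%:R * H by rewrite -HE addrC subrK.
(* [a] is [U(theta) / q]: the [f] term vanishes at [theta], and [r(theta) = z * q]. *)
pose a := (map_poly intr (W * S)).[theta] * z.
have int_theta : integral theta by exists f.
have int_a : integral a by apply: integral_mul => //; apply: integral_hornerZ.
have aU : a * (map_poly intr q%:R).[theta] = (map_poly intr U).[theta].
  rewrite !(rmorphM, rmorphD) /= !(hornerM, hornerD) (rootP f0) -zq /a.
  by rewrite rmorphM hornerM rmorph_nat -polyC_natr hornerC /=; ring.
clearbody U.
have aH : a * (map_poly intr P).[theta] = (map_poly intr (- H)).[theta].
  apply: (mulIf q0); have := rootP f0; rewrite {1}fH.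
  rewrite rmorphD !rmorphM /= hornerD !hornerM -aU rmorph_nat -polyC_natr.
  rewrite hornerC.
  move/eqP; rewrite addr_eq0 => /eqP E.
  by rewrite rmorphN hornerN mulNr [X in - X]mulrC -E; ring.
have P_irr : irreducible_poly (redp q P) by rewrite PE.
have Pf : redp q P %| redp q f by rewrite PE fE wE -mulrA mulrCA dvdp_mulIl.
have Pq : redp q P %| redp q q%:R by rewrite redp_nat // dvdp0.
(* At [theta], [a] is both [U / q] and [- H / P], with denominators divisible by [P] modulo [q].
   Integrality makes [P] divide both numerators, so [U * P] and [q * H] lie in [(q, P)^2]. *)
have PU := dvd_integral f_mon f_irr f0 P_irr Pf Pq int_a aU.
have := dvd_integral f_mon f_irr f0 P_irr Pf (dvdpp _) int_a aH.
rewrite rmorphN dvdpNr => PH.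
case: (f_reg P P_irr); rewrite fH.
by apply: sq_idealD; apply: sq_ideal_mul.
Qed.

Lemma monogenic_of_regular (f : {poly int}) :
    f \is monic -> (2 < size f)%N ->
    irreducible_poly (map_poly intr f : {poly rat}) ->
    (forall q P, prime q -> irreducible_poly (redp q P) -> ~ sq_ideal q P f) ->
  monogenic f.
Proof.
move=> f_mon f_size f_irr f_reg; split=> // L theta f0.
have int_theta : integral theta by exists f.
have horner_sum_Z (V : {poly int}) : (size V <= (size f).-1)%N ->
    (map_poly intr V).[theta] = \sum_(i < (size f).-1) theta ^+ i *~ V`_i.
  move=> V_size.
  rewrite (horner_coef_wide _ (leq_trans (size_poly _ _) V_size)).
  by apply: eq_bigr => i _; rewrite coef_map mulrC mulrzr.
split.
- move=> i; split; first by rewrite rpredX // memv_adjoin.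
  have := integral_hornerZ ('X^i) int_theta.
  by rewrite map_polyXn hornerXn.
- move=> c c0 i.
  pose V : {poly int} := \poly_(j < (size f).-1) (oapp c 0 (insub j)).
  have VE (j : 'I_(size f).-1) : V`_j = c j by rewrite coef_poly ltn_ord valK.
  have V0 : root (map_poly intr V) theta.
    rewrite rootE horner_sum_Z ?size_poly // -[X in _ == X]c0; apply/eqP.
    by apply: eq_bigr => j _; rewrite VE.
  have [Q QE] := root_dvd f_mon f_irr f0 V0.
  rewrite -VE QE; have [->|Q0] := eqVneq Q 0; first by rewrite mul0r coef0.
  (* A nonzero multiple of [f] is at least as long as [f]. *)
  have : (size V <= (size f).-1)%N by apply: size_poly.
  rewrite QE size_Mmonic // leqNgt => /negP[].
  have := size_poly_gt0 Q; rewrite Q0.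
  move: (size Q) (size f) f_size => k l; lia.
move=> z [/Fadjoin_polyP[_ /polyOver1P[p ->] zE] int_z].
suffices [V VE] : exists V : {poly int}, z = (map_poly intr V).[theta].
  have VrE := Pdiv.RingMonic.rdivp_eq f_mon V.
  set r := Pdiv.Ring.rmodp V f in VrE.
  have r_size : (size r <= (size f).-1)%N.
    rewrite -ltnS prednK; first by rewrite Pdiv.Ring.ltn_rmodp monic_neq0.
    by rewrite size_poly_gt0 monic_neq0.
  exists (fun i => r`_i); rewrite -horner_sum_Z // VE {1}VrE rmorphD rmorphM /=.
  by rewrite hornerD hornerM (rootP f0) mulr0 add0r.
have [G [N [N0 zN]]] : exists (G : {poly int}) (N : nat),
    (0 < N)%N /\ z * N%:R = (map_poly intr G).[theta].
  have [G [a a0 pE]] := rat_poly_scale p.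
  have a0' : in_alg L a%:~R != 0 by rewrite fmorph_eq0 intr_eq0.
  have {pE} : z * a%:~R = (map_poly intr G).[theta].
    rewrite zE pE map_polyZ hornerZ -map_poly_comp fmorphV mulrC.
    rewrite -[X in X * _](rmorph_int (in_alg L)) mulVKf //; congr (_.[_]).
    by apply: eq_map_poly => c; apply: (rmorph_int (in_alg L)).
  case: a a0 {a0'} => n n0 zn; first by exists G, n; rewrite lt0n.
  exists (- G), n.+1; split=> //.
  by rewrite rmorphN hornerN -zn NegzE mulrNz mulrN opprK.
elim/ltn_ind: N z {zE} int_z G N0 zN => N IHN z int_z G N0 zN.
have [N1|N1] := leqP N 1.
  by exists G; rewrite -zN (_ : N = 1%N) ?mulr1 //; lia.
(* With [N = M * q], the element [z * M] has denominator [q], hence lies in Z[theta]; so [M] is a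
   smaller denominator for [z]. *)
have q_pr := pdiv_prime N1; have /dvdnP[M NE] := pdiv_dvd N.
have M0 : (0 < M)%N by rewrite lt0n; apply: contraTneq N0 => M0; rewrite NE M0.
have MN : (M < N)%N by rewrite [X in (_ < X)%N]NE ltn_Pmulr // prime_gt1.
have [|||V VE] :=
  @integral_div_prime _ f G L theta (z * M%:R) q_pr f_mon f_irr f0.
- by move=> P; apply: f_reg.
- exact/integral_mul/integral_nat.
- by rewrite -mulrA -natrM -NE.
exact: (IHN M MN z int_z V M0 VE).
Qed.

(** * From monogenicity to the ideal condition *)

(** [P] is merely nonconstant modulo [q] because the lemma is applied to [P \Po 'X^m] and to a gcd,
    which may be reducible. *)
Lemma monogenic_regular (f P : {poly int}) (q : nat) :
  monogenic f -> prime q -> (1 < size (redp q P))%N -> ~ sq_ideal q P f.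
Proof.
move=> [f_mon f_size f_irr f_int] q_pr P1 [A [B [C fE]]].
have [L _ [theta f0 _]] := irredp_FAdjoin f_irr.
have {}f0 : root (map_poly intr f) theta.
  move: f0; rewrite -map_poly_comp (eq_map_poly (g := intr)) // => c.
  exact: (rmorph_int (in_alg L)).
have int_theta : integral theta by exists f.
have [_ _ span] := f_int L theta f0.
have q0 : q%:R != 0 :> L by rewrite natr_fieldExt_neq0 // prime_gt0.
pose ev (V : {poly int}) := (map_poly intr V).[theta].
have evD V W : ev (V + W) = ev V + ev W by rewrite /ev rmorphD hornerD.
have evM V W : ev (V * W) = ev V * ev W by rewrite /ev rmorphM hornerM.
have evq : ev q%:R = q%:R by rewrite /ev rmorph_nat -polyC_natr hornerC.
pose Y := P * A + q%:R * B.
pose a := ev Y / q%:R.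
have aq : a * q%:R = ev P * ev A + q%:R * ev B by rewrite divfK // evD !evM evq.
(* Since [f = P * Y + q ^ 2 * C], this is [f(theta) = 0] divided by [q]. *)
have aP : a * ev P = - q%:R * ev C.
  apply: (mulIf q0); have := rootP f0; rewrite -/(ev f) fE !expr2.
  rewrite !(evD, evM) !evq => /eqP; rewrite addr_eq0 => /eqP E.
  have -> : a * ev P * q%:R = a * q%:R * ev P by ring.
  rewrite aq; transitivity (- (q%:R * q%:R * ev C)); last by ring.
  by rewrite -E; ring.
have aK : a \in <<1; theta>>%AS.
  rewrite rpredM ?rpredV ?rpred_nat // rpred_horner ?memv_adjoin //.
  by apply/polyOverP => i; rewrite coef_map rpred_int.
have int_a : integral a.
  (* The coefficients are integral elements rather than integers, so transitivity of integrality is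
     used. *)
  pose p : {poly L} := Poly [:: ev A * ev C; - ev B; 1].
  have pE : p = [:: ev A * ev C; - ev B; 1] :> seq L.
    by rewrite (@PolyK _ 0) //= oner_neq0.
  apply: (@integral_root_monic int L intr _ p).
  - by rewrite monicE /lead_coef pE.
  - rewrite rootE horner_Poly /= mul0r add0r mul1r; apply/eqP.
    apply: (mulIf q0); rewrite mul0r.
    transitivity (a * (a * q%:R - q%:R * ev B) + q%:R * ev A * ev C).
      by ring.
    rewrite aq; transitivity (a * ev P * ev A + q%:R * ev A * ev C).
      by ring.
    by rewrite aP; ring.
  - have int_ev V : integral (ev V) by apply: integral_hornerZ.
    move=> c; rewrite pE !inE => /or3P[] /eqP ->.
    + by rewrite -evM; apply: int_ev.
    + exact: integral_opp.
    + exact: (integral_nat (intr : {rmorphism int -> L}) 1).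
have [c cE] := span a (conj aK int_a).
pose V := \sum_(i < (size f).-1) (c i)%:P * 'X^i.
have VE : ev V = a.
  rewrite cE /ev rmorph_sum horner_sum; apply: eq_bigr => i _.
  rewrite rmorphM /= map_polyC map_polyXn hornerM hornerC hornerXn.
  by rewrite mulrC mulrzr.
have Y0 : root (map_poly intr (Y - q%:R * V)) theta.
  rewrite rootE rmorphB hornerD hornerN -/(ev Y) -/(ev _) evM evq VE subr_eq0.
  by rewrite mulrC divfK.
have [Q QE] := root_dvd f_mon f_irr f0 Y0.
(* Modulo [q] the two identities give [P * A = Q * P ^+ 2 * A], so [P] would be a unit. *)
have := congr1 (map_poly (intr : int -> 'F_q)) QE.
have := congr1 (map_poly (intr : int -> 'F_q)) fE.
rewrite /Y !(rmorphD, rmorphN, rmorphM) /= redp_nat //.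
rewrite !mul0r oppr0 !addr0 => fqE.
have fq0 : redp q f != 0 by rewrite monic_neq0 // monic_map.
have PA0 : redp q P * redp q A != 0.
  by apply: contraNneq fq0 => PA0; rewrite fqE -mulrA PA0 mulr0.
rewrite fqE -[LHS]mul1r -mulrA [RHS]mulrA => /(mulIf PA0) /esym QP.
have : size (redp q Q * redp q P) == 1 by rewrite QP size_poly1.
by rewrite size_mul_eq1 => /andP[_ /eqP P1']; rewrite P1' in P1.
Qed.

(** * Derivatives and the trinomials [Gpoly m b] *)

(** Each term of the product rule keeps a factor [P] or [q]. *)
Lemma sq_ideal_deriv q P h : prime q ->
  sq_ideal q P h -> redp q P %| redp q h^`().
Proof.
move=> q_pr [A [B [C ->]]]; apply/(redp_dvdP _ _ q_pr).
exists ((P^`() + P^`()) * A + P * A^`()).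
exists (P^`() * B + P * B^`() + q%:R * C^`()).
rewrite !expr2 !derivD !derivM -polyC_natr !derivC polyC_natr.
by move: P^`() A^`() B^`() C^`() (q%:R) => P' A' B' C' Q; ring.
Qed.

Lemma size_Gpoly m b : (0 < m)%N -> size (Gpoly m b) = (2 * m).+1.
Proof.
move=> m0; rewrite /Gpoly -addrA size_polyDl size_polyXn // ltnS.
rewrite (leq_trans (size_polyD _ _)) // geq_max.
rewrite (leq_trans (size_scale_leq _ _)).
  by rewrite (leq_trans (size_polyC_leq1 _)) //; lia.
by rewrite size_polyXn; lia.
Qed.

Lemma Gpoly_monic m b : (0 < m)%N -> Gpoly m b \is monic.
Proof.
move=> m0; rewrite monicE /lead_coef size_Gpoly //= /Gpoly !coefD coefZ.
rewrite !coefXn coefC eqxx (_ : (2 * m == m)%N = false); last by lia.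
by rewrite (_ : (2 * m == 0)%N = false) ?mulr0 ?addr0 //; lia.
Qed.

(** Eisenstein's criterion at a prime divisor of [b], whose square does not divide [b]. *)
Lemma Gpoly_irreducible m b : (0 < m)%N -> 2 <= b -> squarefreez b ->
  irreducible_poly (map_poly intr (Gpoly m b) : {poly rat}).
Proof.
move=> m0 b2 b_sqf; apply/irreducible_rat_int.
have [p p_pr pb] : exists2 p, prime p & (p %| b)%Z.
  by exists (pdiv `|b|); rewrite ?dvdzE /= ?pdiv_dvd // pdiv_prime //; lia.
apply: (eisenstein_crit p_pr).
- by rewrite size_Gpoly //; lia.
- by rewrite (monicP (Gpoly_monic _ _)) // dvdzE /= dvdn1 gtn_eqF // prime_gt1.
- rewrite /Gpoly !coefD coefZ !coefXn coefC eqxx.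
  rewrite !(eq_sym 0%N) muln_eq0 /= (gtn_eqF m0) mulr0 !add0r.
  by apply/negP; apply: (b_sqf p%:Z); rewrite ltz_nat prime_gt1.
move=> i; rewrite size_Gpoly //= => i_m.
rewrite /Gpoly !coefD coefZ !coefXn coefC.
rewrite (_ : (i == 2 * m)%N = false); last by lia.
by rewrite add0r rpredD ?dvdz_mulr //; case: ifP => // _; rewrite dvdz0.
Qed.

Lemma Gpoly_comp m k b : Gpoly k b \Po 'X^m = Gpoly (m * k) b.
Proof.
rewrite /Gpoly !comp_polyD comp_polyZ !comp_Xn_poly comp_polyC.
by rewrite -!exprM mulnCA.
Qed.

Lemma monogenic_Gpoly_comp m k b : (0 < m)%N -> (0 < k)%N -> 2 <= b ->
  squarefreez b -> monogenic (Gpoly (m * k) b) -> monogenic (Gpoly k b).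
Proof.
move=> m0 k0 b2 b_sqf G_mono; apply: monogenic_of_regular.
- exact: Gpoly_monic.
- by rewrite size_Gpoly //; lia.
- exact: Gpoly_irreducible.
move=> q P q_pr [P1 _] [A [B [C GE]]].
apply: (@monogenic_regular _ (P \Po 'X^m) q G_mono q_pr).
  (* The degree of [P] modulo [q] is multiplied by [m], hence stays positive. *)
  rewrite map_comp_poly -ltn_predRL size_comp_poly map_polyXn size_polyXn.
  by rewrite muln_gt0 m0 andbT ltn_predRL.
exists (A \Po 'X^m), (B \Po 'X^m), (C \Po 'X^m).
rewrite -Gpoly_comp GE !(rmorphD, rmorphM, rmorphXn) /=.
by rewrite !rmorph_nat.
Qed.

(** * Primes dividing the exponent *)

(** Over ['F_q] the [q]-th power map is additive and fixes constants, so it sends [g(X)] to [g(X^q)]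
    for [g = Gpoly 1 b]. *)
Lemma Gpoly_Frobenius q b : prime q ->
  exists D, Gpoly q b = Gpoly 1 b ^+ q + q%:R * D.
Proof.
move=> q_pr.
have q_nat : [pchar {poly 'F_q}].-nat q by rewrite pnatE // pchar_poly pchar_Fp.
have fermat (x : 'F_q) : x ^+ q = x.
  by rewrite -[X in _ ^+ X](card_Fp q_pr) expf_card.
have /(redp_eq0 q_pr)[D DE] : redp q (Gpoly q b - Gpoly 1 b ^+ q) = 0.
  apply/eqP; rewrite rmorphB subr_eq0 rmorphXn /= /Gpoly.
  rewrite !rmorphD /= !map_polyZ /= !map_polyXn map_polyC /=.
  rewrite !(exprDn_pchar _ _ q_nat) exprZn -!exprM mul1n muln1 fermat.
  by rewrite -polyC_exp fermat.
by exists D; rewrite -DE addrC subrK.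
Qed.

Lemma not_monogenic_Gpoly q m b (P : {poly int}) :
    prime q -> (0 < m)%N -> irreducible_poly (redp q P) ->
    sq_ideal q P (Gpoly (m * q) b) -> ~ monogenic (Gpoly q b).
Proof.
move=> q_pr m0 P_irr PG G_mono.
have P0 := irredp_neq0 P_irr.
have [D GE] := Gpoly_Frobenius b q_pr.
have g_mon : Gpoly 1 b \is monic by apply: Gpoly_monic.
move: (Gpoly 1 b) g_mon GE => g g_mon GE.
have GmE : Gpoly (m * q) b = (g \Po 'X^m) ^+ q + q%:R * (D \Po 'X^m).
  by rewrite -Gpoly_comp GE rmorphD rmorphM rmorphXn /= rmorph_nat.
have Pg : redp q P %| redp q (g \Po 'X^m).
  have := sq_ideal_dvd q_pr PG.
  rewrite GmE rmorphD rmorphM /= redp_nat // mul0r addr0 rmorphXn.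
  exact: irreducible_dvd_exp.
(* Both [Gpoly (m * q) b] and [g(X^m) ^+ q] lie in [(q, P)^2], hence so does [q * D(X^m)]; then one
   [q] cancels. *)
have PD : redp q P %| redp q (D \Po 'X^m).
  apply: sq_ideal_cancel => //.
  have -> : q%:R * (D \Po 'X^m) = Gpoly (m * q) b - (g \Po 'X^m) ^+ q.
    by rewrite GmE addrC addKr.
  by apply/(sq_idealD PG)/sq_idealN/sq_idealX; rewrite // prime_gt1.
pose d := gcdp (redp q g) (redp q D).
(* Coprimality of [g] and [D] modulo [q] would survive the substitution of [X^m], but [P] divides
   both results. *)
have d1 : (1 < size d)%N.
  have g0 : redp q g != 0 by rewrite monic_neq0 // monic_map.
  have d_gt0 : (0 < size d)%N by rewrite size_poly_gt0 gcdp_eq0 negb_and g0.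
  rewrite ltn_neqAle eq_sym d_gt0 andbT; apply/negP => gD.
  have : coprimep (redp q (g \Po 'X^m)) (redp q (D \Po 'X^m)).
    by rewrite !map_comp_poly coprimep_comp_poly.
  move/coprimepP => /(_ _ Pg PD); rewrite -size_poly_eq1.
  by case: P_irr => P1 _; rewrite gtn_eqF.
have [P' P'E] := redp_surj d.
apply: (monogenic_regular G_mono q_pr (P := P')); first by rewrite P'E.
rewrite GE; apply: sq_idealD.
  by apply: sq_idealX; rewrite ?P'E ?dvdp_gcdl // prime_gt1.
by apply: sq_ideal_mul; rewrite // ?P'E ?dvdp_gcdr // redp_nat // dvdp0.
Qed.

(** * Primes not dividing the exponent *)

Lemma sq_ideal_Gpoly_dvd q n b (P : {poly int}) :
    prime q -> (1 < n)%N -> squarefreez b -> squarefreez (b - 4) ->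
    irreducible_poly (redp q P) -> sq_ideal q P (Gpoly n b) -> (q %| n)%N.
Proof.
move=> q_pr n1 b_sqf b4_sqf P_irr PG; apply/negPn/negP => qn.
have P1 : (1 < size (redp q P))%N by case: P_irr.
have q1 : 1 < q%:Z by rewrite ltz_nat prime_gt1.
(* If [P] divides [X] modulo [q], every term but [b] is a multiple of [X^2], as [n >= 2]; so [b]
   lies in [(q, P)^2]. *)
have [PX | PX] := boolP (redp q P %| redp q 'X).
  apply: (b_sqf q%:Z q1); apply: (sq_ideal_const q_pr P1).
  have [k nE] : exists k, n = k.+2 by exists (n - 2)%N; lia.
  rewrite {}nE in PG.
  rewrite (_ : b%:P = Gpoly k.+2 b - 'X * 'X * ('X^(2 * k.+1) + b *: 'X^k)).
    by apply/(sq_idealD PG)/sq_idealN/sq_idealMr/sq_ideal_mul.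
  rewrite /Gpoly -!mul_polyC !mulnS !exprS !mul2n -addnn !exprD; ring.
have PXn k : ~~ (redp q P %| redp q 'X^k).
  by apply: contra PX; rewrite rmorphXn; apply: irreducible_dvd_exp.
pose W : {poly int} := 'X^n *+ 2 + b%:P.
(* The derivative is [n X^(n-1) W], and [P] is coprime to [n X^(n-1)] modulo [q]. *)
have PW : redp q P %| redp q W.
  have := sq_ideal_deriv q_pr PG.
  have -> : (Gpoly n b)^`() = n%:R * 'X^(n.-1) * W.
    rewrite /Gpoly !derivD derivZ !derivXn derivC addr0 /W -mul_polyC.
    rewrite -[X in X + _]mulr_natl -['X^(n.-1) *+ n]mulr_natl natrM.
    have -> : (2 * n).-1%N = (n.-1 + n)%N by lia.
    by rewrite exprD; ring.
  rewrite rmorphM Gauss_dvdpr /=; last first.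
    rewrite irreducible_poly_coprime // rmorphM rmorph_nat /= mulr_natl.
    rewrite -scaler_nat dvdpZr ?PXn //.
    by rewrite -(dvdn_pcharf (pchar_Fp q_pr)).
  by [].
have : (q%:Z ^+ 2 %| b * (b - 4))%Z.
  apply: (sq_ideal_const q_pr P1).
  rewrite (_ : _%:P = W * W - Gpoly n b * 4%:R).
    apply: sq_idealD; first exact: sq_ideal_mul.
    by apply/sq_idealN/sq_idealMr.
  by rewrite /W /Gpoly mulnC exprM -mul_polyC polyCM polyCB; ring.
rewrite Gauss_dvdzr; first exact: b4_sqf.
(* If [q] divided [b], the trinomial would reduce to [X^(2n)], which [P] does not divide. *)
rewrite coprimezXl // coprimezE /= prime_coprime //; apply/negP => qb.
have := sq_ideal_dvd q_pr PG; apply/negP.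
rewrite /Gpoly -addrA rmorphD /= dvdp_addl //.
have b0 : b%:~R = 0 :> 'F_q.
  by apply/eqP; rewrite -(dvdz_pcharf (pchar_Fp q_pr)) dvdzE.
by rewrite rmorphD /= map_polyZ map_polyC /= b0 scale0r add0r dvdp0.
Qed.

Theorem theorem1p8 (b : int) (n : nat) (hb : 2 <= b)
    (hsqf_b : squarefreez b) (hsqf_b4 : squarefreez (b - 4))
    (hn : (3 <= n)%N) :
  monogenic (Gpoly n b) <->
  (forall p : nat, prime p -> (p %| n)%N -> monogenic (Gpoly p b)).
Proof.
have n0 : (0 < n)%N by apply: leq_trans hn.
split=> [G_mono p p_pr /dvdnP[m nE] | G_mono].
  have m0 : (0 < m)%N.
    by rewrite lt0n; apply: contraTneq n0 => m0; rewrite nE m0.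
  rewrite nE in G_mono; exact: monogenic_Gpoly_comp (prime_gt0 p_pr) _ _ G_mono.
apply: monogenic_of_regular.
- exact: Gpoly_monic.
- by rewrite size_Gpoly //; lia.
- exact: Gpoly_irreducible.
move=> q P q_pr P_irr PG.
(* A prime [q] violating the ideal condition divides [n], so the hypothesis applies to
   [Gpoly q b]. *)
have qn : (q %| n)%N.
  exact: sq_ideal_Gpoly_dvd q_pr (ltnW hn) hsqf_b hsqf_b4 P_irr PG.
have /dvdnP[m nE] := qn.
have m0 : (0 < m)%N by rewrite lt0n; apply: contraTneq n0 => m0; rewrite nE m0.
rewrite nE in PG.
exact: not_monogenic_Gpoly q_pr m0 P_irr PG (G_mono q q_pr qn).
Qed.
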